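(* There exists a (finite) game in extensive form with imperfect information and with perfect recall that is not interpretable as a spacetime game with perfect information. In particular, the class of games in extensive form with imperfect information that are interpretable as spacetime games is a strict subclass of the class of all games in extensive form with imperfect information.
   Context: **Games in extensive form with imperfect information.** Such a game is a tuple $(N,A,H,Z,\chi,\rho,\sigma,u,I)$ where $N$ is a set of players, $A$ a set of actions, $H$ a set of choice nodes, $Z$ a set of outcomes, $\chi:H\to\mathcal{P}(A)$ gives the available actions, $\rho:H\to N$ the player at each node, $\sigma$ is the successor function mapping pairs $(h,a)\in H\times A$ to $H\cup Z$, defined only if $a\in\chi(h)$, injective, and organizing $H\cup Z$ as a single tree (one connected component with a single root), $u$ assigns a real payoff to each player and outcome, and $I$ is a partition of $H$ into information sets (each indexed by a player $i$ and an integer $j$) such that $\rho(h)=i$ for all $h\in I_{i,j}$ and $\chi(h)=\chi(h')$ for all $h,h'\in I_{i,j}$. Perfect recall has its standard meaning: for any two nodes in the same information set of player $i$, the sequences of information sets of $i$ visited and actions taken by $i$ on the paths from the root to these nodes are the same. **Spacetime games.** Minkowski spacetime is $\mathbb{R}^d$ ($d\ge 2$, usually $d=4$) with a flat metric of signature $(d-1,1)$; write its points as $(x,t)$ with $x\in\mathbb{R}^{d-1}$, $t\in\mathbb{R}$ (units with speed of light 1). A raw assignment is a partial function $\alpha$ from $\hat I$ to $A$ with $\alpha(P)\in\hat\chi(P)$ wherever it is defined; $\alpha(P)=\perp$ means undefined at $P$. A raw assignment $\alpha$ is a restriction of $\beta$ (and $\beta$ an extension of $\alpha$) if $\alpha(P)\ne\perp$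 implies $\alpha(P)=\beta(P)$, for all $P$. A spacetime game with perfect information is a tuple $\Gamma'=(N,A,\hat I,\prec,\hat\chi,\gamma,u)$ where: - $N$ is a set of agents and $A$ a set of actions; - $\hat I$ is a finite set of decision points $\hat I_{i,j}$, where $i\in N$ is the agent deciding at $\hat I_{i,j}$ and $j\in\mathbb{N}$ is an index; each has a location $\mathcal{L}(\hat I_{i,j})\in\mathbb{R}^d$; - $\prec$ (timelike precedence) is the relation induced by the locations: for decision points $P,Q$ with locations $(x_P,t_P)$ and $(x_Q,t_Q)$, $P\prec Q$ iff the locations are different and $t_Q-t_P\ge\|x_Q-x_P\|$ (lightlike separation counts as timelike; colocated points count as spacelike-separated); - $\hat\chi:\hat I\to\mathcal{P}(A)$ gives the (nonempty) set of actions available at each decision point; - $\gamma$ associates with each decision point $P$ its contingency coordinates $\gamma_P$, a raw assignment defined only on decision points $Q\prec P$. Say that $Q$ actually precedes $P$ if $Q\prec P$ and $\gamma_Q$ is a restriction of $\gamma_P$. The contingency coordinates are required to be consistent: for all $P,Q\in\hat I$, $\gamma_P(Q)\neq\perp$ if and only if $Q$ actually precedes $P$; - $u$ assigns a real number (payoff) to each agent and complete history, where complete histories are defined next. A history is a raw assignment $h$ such that for all decision points $P,Q$: if $h(P)\ne\perp$ and $\gamma_P(Q)\neq\perp$ then $h(Q)=\gamma_P(Q)$. A history is complete if no history that assigns actions to strictly more decision points extends it; otherwise it is incomplete. **Construction.** A linearization of $\Gamma'$ is a listing $\hat I_1,\dots,\hat I_n$ of all decision points such that $P\prec Q$ implies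 $P$ is listed before $Q$. A history $h$ is a prefix of a history $h'$ if there is an integer $k$ such that $h$ and $h'$ match exactly on the first $k$ decision points and $h$ leaves all decision points beyond the $k$-th unassigned. $Z$ is the set of all complete histories; $H$ is the set of all incomplete histories that are a prefix of a complete history. $H\cup Z$ is given the tree structure that is the transitive reduction of the prefix relation (a parent is a prefix of its children). For each $h\in H$, all children of $h$ differ from $h$ exactly by assigning an action to one and the same decision point, denoted $\hat I(h)$. Define: $\rho(h)$ is the agent deciding at $\hat I(h)$; $\chi(h)=\hat\chi(\hat I(h))$; for $a\in\chi(h)$, $\sigma(h,a)$ is the history obtained from $h$ by assigning $a$ to $\hat I(h)$; $I$ is the partition of $H$ into the sets $I_l=\{h\in H:\hat I(h)=\hat I_l\}$. The result $\hat\Gamma'=(N,A,H,Z,\chi,\rho,\sigma,u,I)$ is a game in extensive form with imperfect information. **Interpretability.** A game $\Gamma$ in extensive form with imperfect information is interpretable as a spacetime game if there exist a spacetime game with perfect information $\Gamma'$ and a linearization of it such that the constructed game $\hat\Gamma'$ is isomorphic to $\Gamma$, i.e. the two games are the same up to bijections between their sets of players, actions, choice nodes and outcomes (compatible with all the structure: available actions, players at nodes, successor function, payoffs and information partition). *)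

(* Defs.v *)
From mathcomp Require Import all_boot all_order all_algebra.
From mathcomp Require Import boolp classical_sets functions cardinality reals.
From Stdlib Require Import Relation_Operators.

Set Implicit Arguments.
Unset Strict Implicit.
Unset Printing Implicit Defensive.

Import Order.TTheory GRing.Theory Num.Theory.

Local Open Scope classical_set_scope.

(** * Games in extensive form with imperfect information *)

Record efg_data (R : realType) := EFGData {
  player : Type;
  action : Type;
  choice_node : Type;
  outcome : Type;
  avail : choice_node -> set action;
  turn : choice_node -> player;
  succ : choice_node -> action -> option (choice_node + outcome);
  payoff : player -> outcome -> R;
  infoset : player -> nat -> set choice_node }.

Section ExtensiveForm.
Variables (R : realType) (G : efg_data R).

Definition node : Type := (choice_node G + outcome G)%type.

Definition edge (x y : node) : Prop :=
  exists h a, x = inl h /\ succ h a = Some y.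

Definition is_root (x : node) : Prop := forall y, ~ edge y x.

(* Only the nonempty members of the family [infoset] are cells; an index
   [(i, j)] that is not in use is mapped to the empty set. *)
Record efg_axioms : Prop := {
  avail_nonempty : forall h : choice_node G, avail h !=set0;
  succ_defined : forall (h : choice_node G) a, succ h a <> None <-> avail h a;
  succ_inj : forall (h h' : choice_node G) a a' x,
    succ h a = Some x -> succ h' a' = Some x -> h = h' /\ a = a';
  tree_root : exists! r : node, is_root r;
  tree_connected : forall x y : node, clos_refl_sym_trans node edge x y;
  infoset_partition :
    partition [set ij : player G * nat | infoset ij.1 ij.2 !=set0]
              (fun ij => infoset ij.1 ij.2) [set: choice_node G];
  infoset_turn : forall i j (h : choice_node G), infoset i j h -> turn h = i;
  infoset_avail : forall i j (h h' : choice_node G),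
    infoset i j h -> infoset i j h' -> avail h = avail h' }.

End ExtensiveForm.

Record efg (R : realType) := EFG {
  efg_struct :> efg_data R;
  efg_ax : efg_axioms efg_struct }.

Definition finite_efg (R : realType) (G : efg_data R) : Prop :=
  [/\ finite_set [set: player G], finite_set [set: action G],
      finite_set [set: choice_node G] & finite_set [set: outcome G]].

(** ** Perfect recall *)

Section PerfectRecall.
Variables (R : realType) (G : efg_data R).

(* [path_to x s]: [s] lists the pairs (choice node, action taken there) met on
   the path from the root to [x], in chronological order. *)
Inductive path_to : node G -> seq (choice_node G * action G) -> Prop :=
| path_root r : is_root r -> path_to r [::]
| path_succ h a x s :
    path_to (inl h) s -> succ h a = Some x -> path_to x (rcons s (h, a)).

Definition infoset_of (h : choice_node G) : set (choice_node G) :=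
  [set h' | exists i j, infoset i j h /\ infoset i j h'].

Definition experience (i : player G) (s : seq (choice_node G * action G)) :
    seq (set (choice_node G) * action G) :=
  [seq (infoset_of p.1, p.2) | p <- s & `[< turn p.1 = i >]].

Definition perfect_recall : Prop :=
  forall i j (h h' : choice_node G) s s',
    infoset i j h -> infoset i j h' -> path_to (inl h) s -> path_to (inl h') s' ->
    experience i s = experience i s'.

End PerfectRecall.

(** ** Isomorphism *)

Definition infosets (R : realType) (G : efg_data R) : set (set (choice_node G)) :=
  [set S | S !=set0 /\ exists i j, S = infoset i j].

(* The numbering of the information sets of a player need not be preserved. *)
Definition efg_iso (R : realType) (G G' : efg_data R) : Prop :=
  exists (fN : player G -> player G') (fA : action G -> action G')
         (fH : choice_node G -> choice_node G') (fZ : outcome G -> outcome G'),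
  let fHZ (x : node G) : node G' :=
    match x with inl h => inl (fH h) | inr z => inr (fZ z) end in
  [/\ bijective fN, bijective fA, bijective fH & bijective fZ] /\
  [/\ forall h a, avail (fH h) (fA a) <-> avail h a,
      forall h, turn (fH h) = fN (turn h),
      forall h a, succ (fH h) (fA a) = omap fHZ (succ h a),
      forall i z, payoff (fN i) (fZ z) = payoff i z
    & forall S, infosets (fH @` S) <-> infosets S].

(** * Spacetime games with perfect information *)

(* The library norm on row vectors is the sup norm. *)
Definition enorm (R : realType) (n : nat) (x : 'rV[R]_n) : R :=
  Num.sqrt (\sum_(i < n) x ord0 i ^+ 2)%R.

(* A point [(x, t)] of d-dimensional Minkowski spacetime. *)
Definition spacetime (R : realType) (d : nat) : Type := ('rV[R]_d.-1 * R)%type.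

Definition timelike_le (R : realType) (d : nat) (p q : spacetime R d) : Prop :=
  p <> q /\ (enorm (q.1 - p.1) <= q.2 - p.2)%R.

Definition raw_assignment (D A : Type) (chi : D -> set A) (h : D -> option A) :=
  forall P a, h P = Some a -> chi P a.

Definition restriction_of (D A : Type) (h h' : D -> option A) : Prop :=
  forall P, h P <> None -> h P = h' P.

(* Everything but the payoffs. [dlabel P = (i, j)] says that [P] is the decision
   point of agent [i] with index [j]. *)
Record spacetime_form (R : realType) := SpacetimeForm {
  agent_type : Type;
  act_type : Type;
  dpoint : finType;
  dlabel : dpoint -> agent_type * nat;
  dlabel_inj : injective dlabel;
  dim : nat;
  dim_ge2 : 2 <= dim;
  location : dpoint -> spacetime R dim;
  davail : dpoint -> set act_type;
  davail_nonempty : forall P, davail P !=set0;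
  contingency : dpoint -> dpoint -> option act_type;
  contingency_raw : forall P, raw_assignment davail (contingency P);
  contingency_past : forall P Q, contingency P Q <> None ->
    timelike_le (location Q) (location P);
  contingency_consistent : forall P Q, contingency P Q <> None <->
    timelike_le (location Q) (location P) /\
    restriction_of (contingency Q) (contingency P) }.

Section Histories.
Variables (R : realType) (F : spacetime_form R).
Implicit Types (P Q : dpoint F) (h : dpoint F -> option (act_type F)).

Definition agent P : agent_type F := (dlabel P).1.

Definition precedes P Q : Prop := timelike_le (location P) (location Q).

Definition history h : Prop :=
  raw_assignment (@davail R F) h /\
  forall P Q, h P <> None -> contingency P Q <> None -> h Q = contingency P Q.

Definition assigned h : {set dpoint F} := [set P : dpoint F | isSome (h P)]%SET.

Definition complete h : Prop :=
  history h /\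
  forall h', history h' -> restriction_of h h' -> ~ (assigned h \proper assigned h').

Definition complete_history : Type := {h : dpoint F -> option (act_type F) | complete h}.

End Histories.

Record spacetime_game (R : realType) := SpacetimeGame {
  form :> spacetime_form R;
  dpayoff : agent_type form -> complete_history form -> R }.

(** * From spacetime games to games in extensive form *)

Definition linearization (R : realType) (F : spacetime_form R) (L : seq (dpoint F)) : Prop :=
  [/\ uniq L, forall P, P \in L
    & forall P Q, precedes P Q -> index P L < index Q L].

Section Construction.
Variables (R : realType) (F : spacetime_form R) (L : seq (dpoint F)).

Local Notation assignment := (dpoint F -> option (act_type F)).
Implicit Types (P Q : dpoint F) (h : assignment) (k : nat).

Definition is_prefix h h' : Prop :=
  exists k, (forall P, index P L < k -> h P = h' P) /\
            (forall P, k <= index P L -> h P = None).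

Definition choice_history h : Prop :=
  [/\ history h, ~ complete h & exists2 h', complete h' & is_prefix h h'].

Definition tree_history h : Prop := choice_history h \/ complete h.

(* The covering relation of [is_prefix], i.e. its transitive reduction. *)
Definition child h h' : Prop :=
  [/\ tree_history h, tree_history h', is_prefix h h', h <> h'
    & forall g, tree_history g -> is_prefix h g -> is_prefix g h' -> g = h \/ g = h'].

Definition assign h P (a : act_type F) : assignment :=
  fun Q => if Q == P then Some a else h Q.

Definition decides h P : Prop :=
  (exists h', child h h') /\
  forall h', child h h' -> h P = None /\ exists a, h' = assign h P a.


(** ** The construction is well defined *)

Hypothesis Llin : linearization L.

Let pos P := index P L.

Let pos_inj P Q : pos P = pos Q -> P = Q.
Proof.
case: Llin => _ Lin _; move=> e.
by rewrite -(nth_index P (Lin P)) -(nth_index P (Lin Q)) -/(pos P) -/(pos Q) e.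
Qed.

Let pos_lt P : pos P < size L.
Proof. by case: Llin => _ Lin _; rewrite index_mem. Qed.

Let gamma_pos P Q : contingency P Q <> None -> pos Q < pos P.
Proof. by case: Llin => _ _ Lp /contingency_past; apply: Lp. Qed.

(* [active h P]: the contingencies of [P] are realized in [h]. *)
Definition active h P : Prop :=
  forall Q, contingency P Q <> None -> h Q = contingency P Q.

Lemma history_active h P : history h -> h P <> None -> active h P.
Proof. by move=> [_ hh] hP Q; apply: hh. Qed.

Lemma active_eq h h' P :
  (forall Q, pos Q < pos P -> h Q = h' Q) -> active h P -> active h' P.
Proof. by move=> e aP Q nQ; rewrite -e ?aP//; apply: gamma_pos. Qed.

Lemma assign_same h P a : assign h P a P = Some a.
Proof. by rewrite /assign eqxx. Qed.

Lemma assign_other h P a Q : Q <> P -> assign h P a Q = h Q.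
Proof. by move=> /eqP/negPf e; rewrite /assign e. Qed.

Lemma history_assign h P a :
  history h -> h P = None -> active h P -> davail P a -> history (assign h P a).
Proof.
move=> [hr hh] hP aP Pa; split=> [Q b|Q Q' hQ nQ'].
  have [->|/eqP QP] := eqVneq Q P; first by rewrite assign_same => -[<-].
  by rewrite assign_other//; apply: hr.
have [Q'P|/eqP Q'P] := eqVneq Q' P; last first.
  rewrite assign_other//; have [QP|/eqP QP] := eqVneq Q P.
    by rewrite QP in nQ' *; apply: aP.
  by rewrite assign_other// in hQ; apply: hh.
have [QP|/eqP QP] := eqVneq Q P.
  by have := gamma_pos nQ'; rewrite QP Q'P ltnn.
rewrite assign_other// in hQ; have := hh _ _ hQ nQ'.
by rewrite Q'P hP => e; case: nQ'; rewrite Q'P -e.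
Qed.

(* [h] is a history that stops before position [k], and decides everything it
   activates up to there. *)
Definition upto k h : Prop :=
  [/\ history h, forall P, k <= pos P -> h P = None
    & forall P, pos P < k -> active h P -> h P <> None].

Lemma completeP h : complete h <-> history h /\ forall P, active h P -> h P <> None.
Proof.
split=> [[hh hc]|[hh ha]]; split=> //.
  move=> P aP hP; have [a Pa] := davail_nonempty P.
  apply: (hc _ (history_assign hh hP aP Pa)).
    by move=> Q hQ; rewrite assign_other// => QP; rewrite QP in hQ.
  apply/properP; split.
    apply/fintype.subsetP => Q; rewrite !inE /assign.
    by case: eqP.
  by exists P; rewrite !inE ?assign_same// hP.
move=> h' hh' hr /properP[_ [P0]]; rewrite !inE => h'P0 hP0.
pose p := [pred P | isSome (h' P) && ~~ isSome (h P)].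
have pP0 : p P0 by rewrite /= h'P0 hP0.
case: (@arg_minnP _ P0 p pos pP0) => P /andP[h'P hP] Pmin.
apply: (ha P); last by move: hP; case: (h P).
apply: (@active_eq h'); last by apply: history_active => //; move: h'P; case: (h' P).
move=> Q QP; case hQ : (h Q) => [b|].
  by rewrite -hr ?hQ.
case h'Q : (h' Q) => [b|//].
by have := Pmin Q; rewrite /= h'Q hQ leqNgt QP => /(_ isT).
Qed.

Lemma upto_complete h : complete h <-> upto (size L) h.
Proof.
rewrite completeP; split=> [[hh ha]|[hh _ ha]].
  by split=> [//|P|P _]; [rewrite leqNgt pos_lt|exact: ha].
by split=> // P; apply: ha.
Qed.

Lemma upto_trunc h k : complete h ->
  upto k (fun P => if pos P < k then h P else None).
Proof.
move=> /completeP[[hr hh] ha]; split=> [|P|P Pk aP].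
- split=> [P a|P Q]; first by case: ifP => // _; apply: hr.
  case: ifP => // Pk hP nQ; rewrite (ltn_trans (gamma_pos nQ) Pk).
  exact: hh.
- by rewrite ltnNge => ->.
- rewrite Pk; apply: ha => Q nQ.
  by rewrite -aP// (ltn_trans (gamma_pos nQ) Pk).
Qed.

Lemma upto_extend k h : upto k h ->
  exists2 h', complete h' & forall P, pos P < k -> h P = h' P.
Proof.
have [m] := ubnP (size L - k); elim: m k h => // m IH k h.
rewrite ltnS => km hk; have [kL|Lk] := ltnP k (size L); last first.
  exists h => //; apply/upto_complete; case: hk => hh _ hk.
  by split=> [//|P|P PL]; [rewrite leqNgt pos_lt|apply: hk; apply: leq_trans Lk].
have [P Pk] : exists P, pos P = k.
  have [Lu _ _] := Llin; have [x0] : exists x0 : dpoint F, True.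
    by case: (L) kL => // x0; exists x0.
  by exists (nth x0 L k); rewrite /pos index_uniq.
have mk : size L - k.+1 < m.
  by apply: leq_trans km; rewrite subnS prednK ?subn_gt0.
case: hk => hh hN ha; have hP : h P = None by apply: hN; rewrite Pk.
have [aP|naP] := pselect (active h P); last first.
  have [|h' ch' e] := IH k.+1 h mk.
    split=> [//|Q Qk|Q]; first by apply: hN; apply: ltnW.
    rewrite ltnS leq_eqVlt => /orP[/eqP Qk|]; last exact: ha.
    by rewrite (@pos_inj Q P) ?Pk.
  by exists h' => // Q Qk; apply: e; apply: ltnW.
have [a Pa] := davail_nonempty P.
have [|h' ch' e] := IH k.+1 (assign h P a) mk.
  split=> [|Q kQ|Q]; first exact: history_assign.
    rewrite assign_other; first by apply: hN; apply: ltnW.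
    by move=> QP; rewrite QP Pk ltnn in kQ.
  rewrite ltnS leq_eqVlt => /orP[/eqP Qk|Qk].
    by rewrite (@pos_inj Q P) ?Pk// assign_same.
  rewrite assign_other; last by move=> QP; rewrite QP Pk ltnn in Qk.
  move=> aQ; apply: ha => //; apply: active_eq aQ => Q' Q'Q.
  rewrite assign_other// => Q'P; move: (ltn_trans Q'Q Qk).
  by rewrite Q'P Pk ltnn.
exists h' => // Q Qk; rewrite -e; last exact: ltnW.
by rewrite assign_other// => QP; rewrite QP Pk ltnn in Qk.
Qed.

Lemma treeP h : tree_history h <-> exists k, upto k h.
Proof.
split=> [[[hh hc [h' ch' [k [e hN]]]]|ch]|[k hk]].
- exists k; suff -> : h = (fun P => if pos P < k then h' P else None).
    exact: upto_trunc.
  by apply/funext => P; case: ltnP => Pk; [exact: e|exact: hN].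
- by exists (size L); apply/upto_complete.
- have [ch|nc] := pselect (complete h); [by right|left].
  have [h' ch' e] := upto_extend hk; case: hk => hh hN _.
  by split=> //; exists h' => //; exists k.
Qed.

(* [P] is the first undecided point activated by [h]. *)
Definition next_at h P : Prop := [/\ h P = None, active h P & upto (pos P) h].

Lemma next_exists h : choice_history h -> exists P, next_at h P.
Proof.
move=> H; have [k hk] := (treeP h).1 (or_introl H).
case: H => hh nc _.
have [P0 [aP0 hP0]] : exists P, active h P /\ h P = None.
  apply: contrapT => nex; apply: nc; apply/completeP; split=> // P aP hP.
  by apply: nex; exists P.
pose p := [pred P | `[< active h P >] && (~~ isSome (h P))].
have pP0 : p P0 by rewrite /= hP0 andbT; apply/asboolP.
case: (@arg_minnP _ P0 p pos pP0) => P /andP[/asboolP aP hP] Pmin.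
have {}hP : h P = None by move: hP; case: (h P).
exists P; split=> //; case: hk => _ hN ha.
have kP : k <= pos P by rewrite leqNgt; apply/negP => /ha/(_ aP).
split=> // Q QP; first by apply: hN; apply: leq_trans QP.
move=> aQ hQ; have := Pmin Q; rewrite /= hQ leqNgt QP andbT => /(_ _)/negP.
by apply=> //; apply/asboolP.
Qed.

Lemma next_choice h P : next_at h P -> choice_history h.
Proof.
move=> [hP aP hu]; have [//|ch] : tree_history h by apply/treeP; exists (pos P).
by move/completeP: ch => [_ /(_ P aP)].
Qed.

Lemma next_assign h P a : next_at h P -> davail P a ->
  upto (pos P).+1 (assign h P a).
Proof.
move=> [hP aP [hh hN ha]] Pa.
split=> [|Q kQ|Q]; first exact: history_assign.
  rewrite assign_other; first by apply: hN; apply: ltnW.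
  by move=> QP; rewrite QP ltnn in kQ.
rewrite ltnS leq_eqVlt => /orP[/eqP/pos_inj->|Qk]; first by rewrite assign_same.
rewrite assign_other; last by move=> QP; rewrite QP ltnn in Qk.
move=> aQ; apply: ha => //; apply: active_eq aQ => Q' Q'Q.
by rewrite assign_other// => Q'P; move: (ltn_trans Q'Q Qk); rewrite Q'P ltnn.
Qed.

Lemma prefix_restr h h' P : is_prefix h h' -> h P <> None -> h P = h' P.
Proof.
by move=> [k [e hN]] hP; apply: e; rewrite ltnNge; apply/negP => /hN.
Qed.

Lemma prefix_next h P a : next_at h P -> is_prefix h (assign h P a).
Proof.
move=> [hP aP [_ hN _]]; exists (pos P); split=> // Q QP.
by rewrite assign_other// => e; rewrite e ltnn in QP.
Qed.

Lemma next_child h P a : next_at h P -> davail P a -> child h (assign h P a).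
Proof.
move=> nP Pa; split.
- by left; apply: next_choice nP.
- by apply/treeP; exists (pos P).+1; apply: next_assign.
- exact: prefix_next.
- by move=> e; case: nP; rewrite e assign_same.
move=> g gt hg gh'.
have gE Q : Q <> P -> g Q = h Q.
  move=> QP; case hQ : (h Q) => [b|].
    by rewrite -(prefix_restr hg) ?hQ.
  case gQ : (g Q) => [b|//].
  by move: (@prefix_restr _ _ Q gh'); rewrite gQ assign_other// hQ; apply.
case gP : (g P) => [b|]; [right|left]; apply/funext => Q;
    have [->|/eqP QP] := eqVneq Q P.
- by rewrite (prefix_restr gh')// gP.
- by rewrite assign_other ?gE.
- by rewrite gP; case: nP.
- exact: gE.
Qed.

Lemma child_next h P h' : next_at h P -> child h h' ->
  exists2 a, davail P a & h' = assign h P a.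
Proof.
move=> nP [_ h't hpre hne hcov].
have [k' [hh' h'N h'a]] := (treeP h').1 h't.
have [j [ej jN]] := hpre.
have [P0 [jP0 h'P0]] : exists P0, j <= pos P0 /\ h' P0 <> None.
  apply: contrapT => nex; apply: hne; apply/funext => Q.
  have [Qj|jQ] := ltnP (pos Q) j; first exact: ej.
  rewrite jN//; case h'Q : (h' Q) => [b|//]; exfalso.
  by apply: nex; exists Q; rewrite h'Q.
pose p := [pred Q | (j <= pos Q) && isSome (h' Q)].
have pP0 : p P0 by rewrite /= jP0; move: h'P0; case: (h' P0).
case: (@arg_minnP _ P0 p pos pP0) => P' /andP[jP' h'P'] Pmin.
have {}h'P' : h' P' <> None by move: h'P'; case: (h' P').
have eP' Q : pos Q < pos P' -> h Q = h' Q.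
  move=> QP'; have [Qj|jQ] := ltnP (pos Q) j; first exact: ej.
  rewrite jN//; case h'Q : (h' Q) => [b|//].
  by have := Pmin Q; rewrite /= jQ h'Q leqNgt QP' => /(_ isT).
have [hP aP [hh hN ha]] := nP.
have aP' : active h P'.
  apply: (@active_eq h'); last exact: history_active.
  by move=> Q QP'; rewrite eP'.
have ePP' : P = P'.
  apply: pos_inj; apply/eqP; rewrite eqn_leq; apply/andP; split.
    by rewrite leqNgt; apply/negP => /ha/(_ aP'); rewrite jN.
  rewrite leqNgt; apply/negP => PP'.
  have Pk' : pos P < k'.
    by apply: ltn_trans PP' _; rewrite ltnNge; apply/negP => /h'N.
  apply: (h'a _ Pk'); last by rewrite -eP'.
  by apply: active_eq aP => Q QP; apply: eP'; apply: ltn_trans QP PP'.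
rewrite -{P'}ePP' in jP' h'P' Pmin eP' aP' *.
case h'P : (h' P) h'P' => [a|//] _.
have Pa : davail P a by case: hh' => hr _; apply: hr.
exists a => //.
have := hcov (assign h P a); case.
- by apply/treeP; exists (pos P).+1; apply: next_assign.
- exact: prefix_next.
- exists (pos P).+1; split=> Q.
    rewrite ltnS leq_eqVlt => /orP[/eqP/pos_inj->|QP].
      by rewrite assign_same h'P.
    by rewrite assign_other ?eP'// => e; rewrite e ltnn in QP.
  move=> PQ; rewrite assign_other; first by apply: hN; apply: ltnW.
  by move=> e; rewrite e ltnn in PQ.
- by move=> e; move: hP; rewrite -e assign_same.
- by [].
Qed.

Lemma decidesP h P : choice_history h -> (decides h P <-> next_at h P).
Proof.
move=> hH; have [P0 nP0] := next_exists hH.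
split=> [[[h' ch'] dP]|nP].
  have [a _ h'E] := child_next nP0 ch'.
  have [hP [b h'E']] := dP _ ch'.
  have [->//|/eqP PP0] := eqVneq P P0.
  have := assign_same h P b; rewrite -h'E' h'E assign_other ?hP//.
split=> [|h' ch'].
  by have [a Pa] := davail_nonempty P; exists (assign h P a); apply: next_child.
by have [a _ ->] := child_next nP ch'; split; [case: nP|exists a].
Qed.

Definition choice_history_type : Type := {h : assignment | choice_history h}.
Implicit Types (n : choice_history_type).

Lemma decides_exists n : exists P, decides (sval n) P.
Proof.
case: n => h hH /=; have [P nP] := next_exists hH.
by exists P; apply/(decidesP _ hH).
Qed.

(* The decision point written Î(h) in the mathematics. *)
Definition decision n : dpoint F := sval (cid (decides_exists n)).

Lemma decisionP n : next_at (sval n) (decision n).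
Proof.
by apply/decidesP; [exact: svalP n|rewrite /decision; case: cid].
Qed.

Lemma decision_eq n P : next_at (sval n) P -> decision n = P.
Proof.
have [hP aP [_ hN ha]] := decisionP n => -[hP' aP' [_ hN' ha']].
apply: pos_inj; apply/eqP; rewrite eqn_leq; apply/andP; split.
  by rewrite leqNgt; apply/negP => /ha/(_ aP').
by rewrite leqNgt; apply/negP => /ha'/(_ aP).
Qed.

Definition node_of h : option (choice_history_type + complete_history F) :=
  match pselect (complete h), pselect (choice_history h) with
  | left c, _ => Some (inr (exist _ h c))
  | right _, left c => Some (inl (exist _ h c))
  | right _, right _ => None
  end.

Definition successor n (a : act_type F) :=
  if `[< davail (decision n) a >] then node_of (assign (sval n) (decision n) a)
  else None.

Definition node_val (x : choice_history_type + complete_history F) : assignment :=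
  match x with inl n => sval n | inr z => sval z end.

Lemma node_ofP h x : node_of h = Some x <-> node_val x = h.
Proof.
rewrite /node_of; case: pselect => [ch|nch].
  split=> [[<-]//|]; case: x => [[g cg]|[g cg]] /= e.
    by exfalso; case: cg => _ + _; rewrite e.
  by congr (Some (inr _)); apply: eq_exist.
case: pselect => [cH|ncH]; split=> //; first by case=> <-.
  case: x => [[g cg]|[g cg]] /= e; last by exfalso; rewrite e in cg.
  by congr (Some (inl _)); apply: eq_exist.
by case: x => [[g cg]|[g cg]] /= e; exfalso; rewrite e in cg.
Qed.

Lemma node_val_inj : injective node_val.
Proof.
by move=> x y /node_ofP; have /node_ofP -> := erefl (node_val y); case.
Qed.

Lemma node_val_tree x : tree_history (node_val x).
Proof. by case: x => [[h ?]|[h ?]]; [left|right]. Qed.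

Lemma successorP n a x : successor n a = Some x <->
  davail (decision n) a /\ node_val x = assign (sval n) (decision n) a.
Proof.
rewrite /successor; case: asboolP => [da|nda]; last by split=> [//|[]].
by rewrite node_ofP; split=> [|[]].
Qed.

Lemma successor_child n x :
  (exists a, successor n a = Some x) <-> child (sval n) (node_val x).
Proof.
split=> [[a /successorP[da ->]]|/(child_next (decisionP n))[a da e]].
  exact: next_child (decisionP n) da.
by exists a; apply/successorP.
Qed.

End Construction.

Section ConstructedGame.
Variables (R : realType) (G : spacetime_game R) (L : seq (dpoint G)).
Hypothesis Llin : linearization L.

Definition constructed_data : efg_data R := {|
  player := agent_type G;
  action := act_type G;
  choice_node := choice_history_type L;
  outcome := complete_history G;
  avail := fun n => davail (decision Llin n);
  turn := fun n => agent (decision Llin n);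
  succ := successor Llin;
  payoff := @dpayoff R G;
  infoset := fun i l =>
    [set n | agent (decision Llin n) = i /\ onth L l = Some (decision Llin n)] |}.

Lemma constructed_succ_inj (n n' : choice_history_type L) a a' x :
  successor Llin n a = Some x -> successor Llin n' a' = Some x -> n = n' /\ a = a'.
Proof.
move=> /successorP[da e] /successorP[da' e'].
have [hP _ [_ hN _]] := decisionP Llin n; have [hP' _ [_ hN' _]] := decisionP Llin n'.
have ee : assign (sval n) (decision Llin n) a = assign (sval n') (decision Llin n') a'.
  by rewrite -e.
have dd : decision Llin n = decision Llin n'.
  case: (ltngtP (index (decision Llin n) L) (index (decision Llin n') L)) => lt.
  - have /= := congr1 (@^~ (decision Llin n')) ee; rewrite assign_same assign_other.
      by rewrite hN// ltnW.
    by move=> E; rewrite E ltnn in lt.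
  - have /= := congr1 (@^~ (decision Llin n)) ee; rewrite assign_same assign_other.
      by rewrite hN'// ltnW.
    by move=> E; rewrite E ltnn in lt.
  - have [_ Lin _] := Llin; rewrite -(nth_index (decision Llin n) (Lin (decision Llin n))).
    by rewrite lt nth_index.
split; last first.
  by have /= := congr1 (@^~ (decision Llin n)) ee; rewrite assign_same dd assign_same => -[].
case: n n' dd {e e' da da'} ee hP hP' {hN hN'} => [h hH] [h' hH'] /= dd ee hP hP'.
apply: eq_exist; apply/funext => Q.
have [->|/eqP Qd] := eqVneq Q (decision Llin (exist _ h hH)).
  by rewrite hP dd hP'.
have /= := congr1 (@^~ Q) ee; rewrite !assign_other// => E.
by apply: Qd; rewrite dd.
Qed.

Let empty : dpoint G -> option (act_type G) := fun=> None.

Let empty_tree : tree_history L empty.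
Proof. by apply/treeP => //; exists 0; split. Qed.

Let node_exists h : tree_history L h ->
  exists x : choice_history_type L + complete_history G, node_val x = h.
Proof.
by case=> hh; [exists (inl (exist _ h hh))|exists (inr (exist _ h hh))].
Qed.

Let pred_exists (x : node constructed_data) : node_val x <> empty ->
  exists y : node constructed_data, edge y x /\
    (#|assigned (node_val x)| = #|assigned (node_val y)|.+1).
Proof.
move=> xne; have [k [[hr hh] hN ha]] := (treeP Llin _).1 (node_val_tree x).
set h := node_val x in hr hh hN ha xne *.
have [P0 hP0] : exists P, h P <> None.
  apply: contrapT => nex; apply: xne; apply/funext => P.
  by case hP : (h P) => [b|//]; exfalso; apply: nex; exists P; rewrite hP.
pose p := [pred Q | isSome (h Q)].
have pP0 : p P0 by rewrite /=; move: hP0; case: (h P0).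
case: (@arg_maxnP _ P0 p (fun Q => index Q L) pP0) => P /= hP Pmax.
have {}hP : h P <> None by move: hP; case: (h P).
pose g : dpoint G -> option (act_type G) := fun Q => if Q == P then None else h Q.
have gE Q : Q <> P -> g Q = h Q by rewrite /g => /eqP/negPf->.
have gP : g P = None by rewrite /g eqxx.
have Pk : index P L < k by rewrite ltnNge; apply/negP => /hN.
have posI Q : index Q L = index P L -> Q = P.
  case: Llin => _ Lin _ E; rewrite -(nth_index P (Lin Q)) E nth_index//.
have gpos Q Q' : contingency Q Q' <> None -> index Q' L < index Q L.
  by case: Llin => _ _ Lp /contingency_past; apply: Lp.
have past Q : h Q <> None -> Q <> P -> index Q L < index P L.
  move=> hQ QP; rewrite ltn_neqAle; apply/andP; split.
    by apply/eqP => /posI.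
  by apply: Pmax; move: hQ; case: (h Q).
have ng : next_at L g P.
  split=> //.
    move=> Q nQ; rewrite gE; first exact: hh.
    by move=> QP; move: (gpos _ _ nQ); rewrite QP ltnn.
  split=> [|Q PQ|Q QP aQ].
  - split=> [Q b|Q Q' gQ nQ'].
      have [->|/eqP QP] := eqVneq Q P; first by rewrite gP.
      by rewrite gE//; apply: hr.
    have QP : Q <> P by move=> E; rewrite E gP in gQ.
    rewrite gE// in gQ; rewrite gE; first exact: hh.
    move=> Q'P; have := ltn_trans (gpos _ _ nQ') (past _ gQ QP).
    by rewrite Q'P ltnn.
  - have [->//|/eqP QnP] := eqVneq Q P.
    rewrite gE//; case hQ : (h Q) => [b|//].
    have hQ' : h Q <> None by rewrite hQ.
    by have := past _ hQ' QnP; rewrite ltnNge PQ.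
  - have QnP : Q <> P by move=> E; rewrite E ltnn in QP.
    rewrite gE//; apply: ha; first exact: ltn_trans Pk.
    move=> Q' nQ'; rewrite -aQ// gE// => E.
    by have := ltn_trans (gpos _ _ nQ') QP; rewrite E ltnn.
pose n : choice_history_type L := exist _ g (next_choice Llin ng).
have dn : decision Llin n = P by apply: decision_eq.
exists (inl n); split.
  case hPa : (h P) hP => [a|//] _.
  exists n, a; split=> //; apply/successorP; rewrite dn; split; first exact: hr hPa.
  rewrite -/h /=; apply/funext => Q; have [->|/eqP QP] := eqVneq Q P.
    by rewrite assign_same.
  by rewrite assign_other ?gE.
have -> : assigned h = (P |: assigned g)%SET.
  apply/setP => Q; rewrite !inE /g; have [->|//] := eqVneq Q P.
  by case: (h P) hP.
by rewrite cardsU1 !inE gP.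
Qed.

Lemma constructed_axioms : efg_axioms constructed_data.
Proof.
have [r rE] := node_exists empty_tree.
have rroot : @is_root _ constructed_data r.
  move=> y [n [a [_ /successorP[_]]]]; rewrite rE => /(congr1 (@^~ (decision Llin n))).
  by rewrite assign_same.
have conn (x : node constructed_data) : clos_refl_sym_trans _ (@edge _ constructed_data) r x.
  have [m] := ubnP #|assigned (node_val x)|; elim: m x => // m IH x xm.
  have [xe|/pred_exists[y [yx cy]]] := pselect (node_val x = empty).
    by rewrite (@node_val_inj _ _ _ x r) ?rE//; apply: rst_refl.
  apply: (rst_trans _ _ _ y); last exact: rst_step.
  by apply: IH; rewrite cy ltnS in xm.
have [Lu Lin _] := Llin.
split.
- by move=> n; apply: davail_nonempty.
- move=> n a; rewrite /=; split.
    by case E : (successor Llin n a) => [x|//] _; case/successorP: E.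
  move=> da; have [x xE] : exists x : choice_history_type L + complete_history G,
      node_val x = assign (sval n) (decision Llin n) a.
    apply: node_exists; apply/treeP => //; exists (index (decision Llin n) L).+1.
    exact: next_assign (decisionP Llin n) da.
  by have /successorP -> : davail (decision Llin n) a /\
    node_val x = assign (sval n) (decision Llin n) a.
- exact: constructed_succ_inj.
- exists r; split=> // x xroot; apply: (@node_val_inj _ _ L); rewrite rE.
  by apply: contrapT => xne; have [|y [yx _]] := @pred_exists x;
    [exact/nesym|exact: xroot yx].
- move=> x y; apply: rst_trans (conn y); apply: rst_sym; exact: conn.
- split.
  + apply/seteqP; split=> // n _; have /onthP[l nl] := Lin (decision Llin n).
    by exists (agent (decision Llin n), l) => //; exists n.
  + move=> [i l] [i' l'] _ _ [n [/= [<- nl] [<- nl']]]; congr (_, _).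
    have lS : l < size L by rewrite -onthTE nl.
    apply: (onth_inj L _ _ Lu); last by rewrite nl nl'.
    exact: leq_ltn_trans (geq_minr _ _) lS.
  + by [].
- by move=> i l n [].
- by move=> i l n n' /= [_ nl] [_]; rewrite nl => -[->].
Qed.

(* The game written with a hat in the mathematics. *)
Definition constructed_game : efg R := EFG constructed_axioms.

End ConstructedGame.

Definition interpretable (R : realType) (G : efg R) : Prop :=
  exists (S : spacetime_game R) (L : seq (dpoint S)) (Llin : linearization L),
    efg_iso (constructed_game Llin) G.

(* The type [efg R] lives in too large a universe to be the carrier of a
   [classical_sets.set], so classes of games are predicates. *)
Definition strict_subclass (T : Type) (C C' : T -> Prop) : Prop :=
  (forall x, C x -> C' x) /\ exists x, C' x /\ ~ C x.

(* Main.v *)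
Require Import Defs.
From mathcomp Require Import all_boot all_order all_algebra.
From mathcomp Require Import boolp classical_sets functions cardinality reals.
From Stdlib Require Import Relation_Operators.

(** The contingency coordinates of a decision point prescribe at most one action
    at each earlier point.  If two different actions at a node [n] lead to nodes
    deciding at the same point [D], the contingencies of [D] cannot mention the
    point decided at [n]; hence [D] is active after every action at [n], and no
    action at [n] ends the game.  A game violating this: the first player has
    three actions, one ends the game, and the second player moves after the two
    others without distinguishing them. *)

Set Implicit Arguments.
Unset Strict Implicit.
Unset Printing Implicit Defensive.

Local Open Scope classical_set_scope.

Lemma common_decision_no_outcome (R : realType) (F : spacetime_form R)
    (L : seq (dpoint F)) (Llin : linearization L)
    (n m m' : choice_history_type L) (a a' b : act_type F) z :
  a <> a' ->
  successor Llin n a = Some (inl m) -> successor Llin n a' = Some (inl m') ->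
  decision Llin m = decision Llin m' ->
  successor Llin n b <> Some (inr z).
Proof.
move=> aa' /successorP[_ /= mE] /successorP[_ /= m'E] e /successorP[_ /= zE].
have [mD mact _] := decisionP Llin m; have [_ m'act _] := decisionP Llin m'.
rewrite -e in m'act; move: (decision Llin m) mD mact m'act => D mD mact m'act.
set P := decision Llin n in mE m'E zE.
have DP : D <> P by move=> DP; rewrite mE DP assign_same in mD.
have gP : contingency D P = None.
  case gE : (contingency D P) => [c|//].
  have nP : contingency D P <> None by rewrite gE.
  (* [m] and [m'] both realize the contingencies of [D], so [c] would be [a] and [a'] at once. *)
  have := mact _ nP; rewrite -(m'act _ nP) mE m'E !assign_same => -[].
  by move=> E; case: aa'.
(* A complete history decides every point it activates. Away from [P], [z] agrees with [m], so [D]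
   is active but undecided in [z]. *)
have [_ /(_ D) zD] := (completeP Llin _).1 (svalP z).
apply: zD => [Q nQ|]; last by rewrite zE assign_other// -(assign_other (sval n) a DP) -mE.
have QP : Q <> P by move=> QP; rewrite QP in nQ.
by rewrite zE assign_other// -(mact _ nQ) mE assign_other.
Qed.

Section Counterexample.
Variable R : realType.

(* The root is [None]; its action [Some b] leads to the node [Some b], and its
   action [None] to the outcome [None].  The only action at [Some b] is [None],
   leading to the outcome [Some b]. *)
Definition merging_succ (h a : option bool) :
    option (option bool + option bool) :=
  match h, a with
  | None, None => Some (inr None)
  | None, Some b => Some (inl (Some b))
  | Some b, None => Some (inr (Some b))
  | Some _, Some _ => None
  end.

(** [isSome] gives both the turns and the information partition, so [true] cannot tell the two lower
    nodes apart. Reading availability off the successor function makes their compatibility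
    immediate. *)
Definition merging_data : efg_data R := {|
  player := bool;
  action := option bool;
  choice_node := option bool;
  outcome := option bool;
  avail := fun h => [set a | merging_succ h a <> None];
  turn := isSome;
  succ := merging_succ;
  payoff := fun _ _ => 0%R;
  infoset := fun i j => [set h | j = 0 /\ isSome h = i] |}.

Lemma merging_root (x : node merging_data) : is_root x <-> x = inl None.
Proof.
split=> [xr|-> y [h [a [_]]]]; last by case: h a => [?|] [].
case: x xr => [[b|]|[b|]] xr //; exfalso.
- by apply: (xr (inl None)); exists None, (Some b).
- by apply: (xr (inl (Some b))); exists (Some b), None.
- by apply: (xr (inl None)); exists None, None.
Qed.

Lemma merging_connected (x : node merging_data) :
  clos_refl_sym_trans _ (@edge _ merging_data) (inl None) x.
Proof.
have step b : clos_refl_sym_trans _ (@edge _ merging_data) (inl None) (inl (Some b)).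
  by apply: rst_step; exists None, (Some b).
case: x => [[b|]|[b|]]; [exact: step|exact: rst_refl| |].
- by apply: rst_trans (step b) _; apply: rst_step; exists (Some b), None.
- by apply: rst_step; exists None, None.
Qed.

Lemma merging_axioms : efg_axioms merging_data.
Proof.
split.
- by move=> h; exists None; case: h.
- by [].
- by move=> [b|] [b'|] [c|] [c'|] x //= <- // [<-].
- exists (inl None); split=> [|x /merging_root //]; exact/merging_root.
- move=> x y; apply: rst_trans (merging_connected y).
  exact: rst_sym (merging_connected x).
- split.
  + by apply/seteqP; split=> // h _; exists (isSome h, 0) => //=; exists h.
  + by move=> [i j] [i' j'] _ _ [h [/= [-> <-] [-> <-]]].
  + by [].
- by move=> i j h [].
- by move=> i j [b|] [b'|] [_ <-] [] // _ _; apply/seteqP; split=> -[c|].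
Qed.

Definition merging_game : efg R := EFG merging_axioms.

Lemma merging_finite : finite_efg merging_game.
Proof. by split; exact: finite_finset. Qed.

Lemma merging_path_root x s :
  path_to (G := merging_data) x s -> x = inl None -> s = [::].
Proof. by case=> // -[b|] [c|] y t _ //= [<-]. Qed.

(** No player moves twice along a play: a nonroot choice node belongs to [true], and its path
    contains only the root, which belongs to [false]. *)
Lemma merging_no_experience x s : path_to (G := merging_data) x s ->
  forall h, x = inl h -> experience (G := merging_data) (isSome h) s = [::].
Proof.
case=> // -[b|] [c|] y t pt //= [<-] // h [<-].
by rewrite (merging_path_root pt erefl) /experience /=; case: asboolP.
Qed.

Lemma merging_perfect_recall : perfect_recall merging_game.
Proof.
move=> i j h h' s s' [_ <-] [_ h'h] ps ps'.
by rewrite (merging_no_experience ps erefl) -h'h (merging_no_experience ps' erefl).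
Qed.

Lemma merging_not_interpretable : ~ interpretable merging_game.
Proof.
move=> [S [L [Llin [fN [fA [fH [fZ]]]]]]].
move=> /= [[_ [gA fAK gAK] [gH fHK gHK] [gZ fZK gZK]] [_ _ sE _ iE]].
have succE h a x : successor Llin (gH h) (gA a) = Some x ->
    merging_succ h a = Some (match x with inl k => inl (fH k) | inr z => inr (fZ z) end).
  by move=> E; have := sE (gH h) (gA a); rewrite gHK gAK E.
have succ_ex h a : merging_succ h a <> None ->
    exists x, successor Llin (gH h) (gA a) = Some x.
  move=> ne; case E : (successor Llin (gH h) (gA a)) => [x|]; first by exists x.
  by have := sE (gH h) (gA a); rewrite gHK gAK E.
have mid b : successor Llin (gH None) (gA (Some b)) = Some (inl (gH (Some b))).
  have [//|x xE] := succ_ex None (Some b); rewrite xE.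
  by have /= := succE _ _ _ xE; case: x {xE} => [k|z] // [->]; rewrite fHK.
have [//|x xE] := succ_ex None None.
have /= := succE _ _ _ xE; case: x xE => [k|z] // zE _.
(* The information set of [true] is pulled back along the isomorphism. A cell of the constructed
   game fixes a position [j] in [L], so both preimages decide at the same point. *)
have [_ [i [j Sij]]] : infosets (G := constructed_game Llin) (range (gH \o Some)).
  apply/iE; split; first by exists (fH (gH (Some true))), (gH (Some true)) => //; exists true.
  exists true, 0; apply/seteqP; split=> [_ [_ [b _ <-] <-]|[b|] []] //=.
    by rewrite gHK.
  by move=> _ _; exists (gH (Some b)); [exists b|exact: gHK].
have dec b : onth L j = Some (decision Llin (gH (Some b))).
  have : range (gH \o Some) (gH (Some b)) by exists b.
  by rewrite Sij => -[].
apply: (common_decision_no_outcome _ (mid true) (mid false) _ zE).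
  by move=> /(congr1 fA); rewrite !gAK.
by have := dec true; rewrite (dec false) => -[].
Qed.

End Counterexample.

Theorem mainTheorem4 (R : realType) :
  (exists G : efg R, [/\ finite_efg G, perfect_recall G & ~ interpretable G]) /\
  strict_subclass (fun G : efg R => interpretable G) (fun _ : efg R => True).
Proof.
have nint := @merging_not_interpretable R.
split; last by split=> //; exists (merging_game R).
exists (merging_game R); split=> //.
- exact: merging_finite.
- exact: merging_perfect_recall.
Qed.
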